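(* Let $t_0\in\mathbb{R}$ and let $b:[t_0,\infty)\to[0,\infty)$ be a continuous function. Set $$k(t)=-\exp\Bigl(-2\int_{t_0}^t b(s)\,ds\Bigr),\qquad t\ge t_0.$$ Then the zero solution of $u''(t)+b(t)u'(t)+k(t)u(t)=0$ on $[t_0,\infty)$ is stable if and only if $$\int_{t_0}^\infty e^{-\int_{t_0}^s b(\sigma)\,d\sigma}\,ds<\infty.$$
   Context: The zero solution of the second-order equation is called stable if for each $\epsilon>0$ there exists $\delta=\delta(\epsilon,t_0)>0$ such that every solution $u$ on $[t_0,\infty)$ with $u(t_0)^2+u'(t_0)^2<\delta^2$ satisfies $u(t)^2+u'(t)^2<\epsilon^2$ for all $t\ge t_0$. The initial time $t_0$ is fixed. *)

(* Defs.v *)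
From Stdlib Require Import Reals.
From Coquelicot Require Import Coquelicot.
Open Scope R_scope.

Definition ray (t0 : R) : R -> Prop := fun t => t0 <= t.

(* A function on [t0, oo) is encoded by a total function R -> R of which only
   the restriction to [t0, oo) matters: continuity and derivatives are taken
   relative to [t0, oo) (continue_in, D_in), hence are one-sided at t0. *)

(* u solves u'' + b u' + k u = 0 on [t0, oo), with u' = u1 and u'' = u2 there.
   On the ray, u1 and u2 are uniquely determined by u. *)
Definition is_solution (t0 : R) (b k u u1 u2 : R -> R) : Prop :=
  forall t : R, t0 <= t ->
    D_in u u1 (ray t0) t /\
    D_in u1 u2 (ray t0) t /\
    u2 t + b t * u1 t + k t * u t = 0.

Definition zero_solution_stable (t0 : R) (b k : R -> R) : Prop :=
  forall eps : R, 0 < eps ->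
    exists delta : R, 0 < delta /\
      forall u u1 u2 : R -> R,
        is_solution t0 b k u u1 u2 ->
        u t0 ^ 2 + u1 t0 ^ 2 < delta ^ 2 ->
        forall t : R, t0 <= t -> u t ^ 2 + u1 t ^ 2 < eps ^ 2.

(* Main.v *)
Require Import Defs.
From Stdlib Require Import Reals Lra.
From Coquelicot Require Import Coquelicot.
Open Scope R_scope.

(** Write E(t) = exp(-∫b) and S(t) = ∫E, both integrals from t0, so that
    E' = - b E and k = - E^2.  Dividing u' by E turns the equation into a
    system with constant coefficients in the time S: with v = u'/E one has
    u' = E v and v' = (u'' + b u') / E = E u, that is du/dS = v, dv/dS = u.
    Hence (u + v) e^(-S) and (u - v) e^S are constant along every solution
    ([diagonal_coordinates]).

    If S <= M on the ray, these two constants bound u^2 + v^2 by e^(2M) times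
    its initial value ([solution_energy_bound]); since b >= 0 gives E <= 1,
    u^2 + u'^2 is bounded by u^2 + v^2, with equality at t0, and the zero
    solution is stable.  Conversely c e^S is a solution for every c
    ([exponential_solution]), and stability applied to one small nonzero c
    bounds e^S, hence S.  Finally S is nondecreasing, so that it is bounded
    exactly when the improper integral of E converges
    ([ex_RInt_gen_iff_bounded]).

    Values of b to the left of t0 are arbitrary, so all this is done for the
    continuous extension [clamp t0 b], which has the same solutions and the
    same integrals on the ray. *)

(** * Functions on a ray *)

(** Continuity relative to the ray becomes two-sided continuity, as integration
    and the mean value theorem ask.  Differentiability may be lost at a itself,
    but derivatives are only needed in the interior of the ray. *)
Definition clamp (a : R) (f : R -> R) : R -> R := fun t => f (Rmax a t).

Lemma clamp_eq (a : R) (f : R -> R) (t : R) : a <= t -> clamp a f t = f t.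
Proof. intros H; unfold clamp; rewrite Rmax_right; auto. Qed.

Lemma clamp_continuous (a : R) (f : R -> R) :
  (forall t, a <= t -> continue_in f (ray a) t) ->
  forall t, continuous (clamp a f) t.
Proof.
  intros Hf t.
  apply continuity_pt_filterlim.
  intros eps Heps.
  destruct (Hf (Rmax a t) (Rmax_l a t) eps Heps) as [d [Hd Hlim]].
  exists d; split; [exact Hd|].
  intros x [_ Hx]; unfold clamp.
  destruct (Req_dec (Rmax a t) (Rmax a x)) as [Heq|Hneq].
  - rewrite Heq. rewrite (proj2 (dist_refl R_met _ _) eq_refl). exact Heps.
  - apply Hlim; split.
    + split; [apply Rmax_l | exact Hneq].
    + revert Hx. simpl. unfold Rdist.
      (* x |-> max a x is 1-Lipschitz *)
      unfold Rmax, Rabs.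
      destruct (Rle_dec a x), (Rle_dec a t);
        repeat destruct Rcase_abs; lra.
Qed.

Lemma D_in_ray_is_derive (a : R) (f df : R -> R) (t : R) :
  a < t -> D_in f df (ray a) t -> is_derive (clamp a f) t (df t).
Proof.
  intros Hat Hf.
  apply is_derive_Reals, derivable_pt_lim_D_in.
  intros eps Heps.
  destruct (Hf eps Heps) as [d [Hd Hlim]].
  exists (Rmin d (t - a)); split; [apply Rmin_pos; lra|].
  intros x [[_ Hx] Hdist].
  assert (H1 := Rmin_l d (t - a)); assert (H2 := Rmin_r d (t - a)).
  assert (Hax : a <= x).
  { revert Hdist; simpl; unfold Rdist, Rabs; destruct Rcase_abs; lra. }
  rewrite !clamp_eq by lra.
  apply Hlim; split; [split; [exact Hax | exact Hx]|].
  eapply Rlt_le_trans; [exact Hdist | exact H1].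
Qed.

Lemma is_derive_D_in (D : R -> Prop) (f df : R -> R) (t : R) :
  is_derive f t (df t) -> D_in f df D t.
Proof.
  intros Hf.
  apply D_in_imp with (D := no_cond); [easy|].
  now apply derivable_pt_lim_D_in, is_derive_Reals.
Qed.

Lemma constant_of_zero_derivative (a : R) (f : R -> R) :
  (forall t, continuous f t) ->
  (forall t, a < t -> is_derive f t 0) ->
  forall t, a <= t -> f t = f a.
Proof.
  intros Hc Hd t Hat.
  destruct (MVT_gen f a t (fun _ => 0)) as [c [_ Hc']].
  - intros x; rewrite Rmin_left by lra; intros Hx; apply Hd; lra.
  - intros x _; apply continuity_pt_filterlim, Hc.
  - lra.
Qed.

Lemma zero_solution_stable_ext (t0 : R) (b b' k k' : R -> R) :
  (forall t, t0 <= t -> b t = b' t) ->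
  (forall t, t0 <= t -> k t = k' t) ->
  zero_solution_stable t0 b k -> zero_solution_stable t0 b' k'.
Proof.
  intros Hb Hk H eps Heps.
  destruct (H eps Heps) as [d [Hd Hs]].
  exists d; split; [exact Hd|].
  intros u u1 u2 Hu; apply (Hs u u1 u2).
  intros t Ht; rewrite (Hb t Ht), (Hk t Ht); exact (Hu t Ht).
Qed.

(** * Integrals of continuous functions *)

Section Continuous.
Variable f : R -> R.
Hypothesis f_cont : forall t, continuous f t.

Lemma ex_RInt_cont (a c : R) : ex_RInt f a c.
Proof. apply (ex_RInt_continuous (V := R_CompleteNormedModule)); auto. Qed.

Lemma is_derive_RInt_cont (a t : R) : is_derive (RInt f a) t (f t).
Proof.
  apply is_derive_RInt with (a := a); auto.
  apply filter_forall; intros c.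
  apply (RInt_correct (V := R_CompleteNormedModule)), ex_RInt_cont.
Qed.

Hypothesis f_nonneg : forall t, 0 <= f t.

Lemma RInt_nondecreasing (a s t : R) : s <= t -> RInt f a s <= RInt f a t.
Proof.
  intros Hst.
  rewrite <- (RInt_Chasles f a s t) by apply ex_RInt_cont.
  assert (0 <= RInt f s t) by (apply RInt_ge_0; auto using ex_RInt_cont).
  unfold plus; simpl; lra.
Qed.

(** The partial integrals are nondecreasing, so boundedness makes them converge
    to their supremum. *)
Lemma ex_RInt_gen_iff_bounded (a : R) :
  ex_RInt_gen f (at_point a) (Rbar_locally p_infty) <->
  exists M, forall t, a <= t -> RInt f a t <= M.
Proof.
  split.
  - intros [l Hl].
    destruct (Hl (ball l 1) (locally_ball l (mkposreal 1 Rlt_0_1)))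
      as [Q P HQ [N HN] HQP].
    exists (l + 1); intros t _.
    set (s := Rmax t (N + 1)).
    assert (Hs : N < s) by (unfold s; assert (H := Rmax_r t (N + 1)); lra).
    destruct (HQP a s HQ (HN s Hs)) as [y [Hy Hball]].
    simpl in Hy; apply (is_RInt_unique (V := R_CompleteNormedModule)) in Hy.
    assert (RInt f a t <= y)
      by (rewrite <- Hy; apply RInt_nondecreasing, Rmax_l).
    apply Rabs_lt_between' in Hball; lra.
  - intros [M HM].
    destruct (completeness (fun y => exists t, a <= t /\ y = RInt f a t))
      as [l [Hub Hleast]].
    + exists M; intros y [t [Ht ->]]; auto.
    + exists (RInt f a a), a; split; [apply Rle_refl | reflexivity].
    + exists l; intros P [eps HP].
      assert (Hnear : exists s, a <= s /\ l - eps < RInt f a s).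
      { apply Classical_Prop.NNPP; intros Hno.
        assert (l <= l - eps).
        { apply Hleast; intros y [t [Ht ->]].
          apply Rnot_lt_le; intros Hlt; apply Hno; now exists t. }
        assert (H0 := cond_pos eps); lra. }
      destruct Hnear as [s [Has Hs]].
      apply Filter_prod with (Q := fun x => x = a) (R := fun t => s < t).
      * reflexivity.
      * now exists s.
      * intros x t -> Hst; exists (RInt f a t); split.
        -- apply (RInt_correct (V := R_CompleteNormedModule)), ex_RInt_cont.
        -- apply HP.
           assert (RInt f a s <= RInt f a t) by (apply RInt_nondecreasing; lra).
           assert (RInt f a t <= l) by (apply Hub; exists t; split; lra).
           apply Rabs_lt_between'; assert (H1 := cond_pos eps); lra.
Qed.

End Continuous.

(** * Solutions in the time variable S *)

Section Damped.
Variables (t0 : R) (b : R -> R).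
Hypothesis b_cont : forall t, continuous b t.

Definition damping (t : R) : R := exp (- RInt b t0 t).
Definition clock (t : R) : R := RInt damping t0 t.

Lemma damping_pos (t : R) : 0 < damping t.
Proof. apply exp_pos. Qed.

Lemma damping_t0 : damping t0 = 1.
Proof.
  unfold damping; rewrite RInt_point; unfold zero; simpl.
  now rewrite Ropp_0, exp_0.
Qed.

Lemma clock_t0 : clock t0 = 0.
Proof. unfold clock; now rewrite RInt_point. Qed.

Lemma damping_derive (t : R) : is_derive damping t (- b t * damping t).
Proof.
  unfold damping.
  assert (H := is_derive_RInt_cont b b_cont t0 t).
  apply (is_derive_comp exp (fun t => - RInt b t0 t) t
           (exp (- RInt b t0 t)) (- b t)).
  - apply is_derive_Reals, derivable_pt_lim_exp.
  - exact (is_derive_opp (RInt b t0) t (b t) H).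
Qed.

Lemma damping_continuous (t : R) : continuous damping t.
Proof.
  apply (ex_derive_continuous (V := R_NormedModule)).
  eexists; apply damping_derive.
Qed.

Lemma clock_derive (t : R) : is_derive clock t (damping t).
Proof. apply is_derive_RInt_cont, damping_continuous. Qed.

Lemma clock_continuous (t : R) : continuous clock t.
Proof.
  apply (ex_derive_continuous (V := R_NormedModule)).
  eexists; apply clock_derive.
Qed.

Lemma clock_nonneg (t : R) : t0 <= t -> 0 <= clock t.
Proof.
  intros Ht; rewrite <- clock_t0.
  apply RInt_nondecreasing; auto using damping_continuous.
  intros s; apply Rlt_le, damping_pos.
Qed.

Definition stiffness (t : R) : R := - exp (- 2 * RInt b t0 t).

Lemma stiffness_damping (t : R) : stiffness t = - damping t ^ 2.
Proof.
  unfold stiffness, damping; simpl; rewrite Rmult_1_r, <- exp_plus.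
  do 2 f_equal; lra.
Qed.

(** Direct computation; it is the growing mode e^S of d^2u/dS^2 = u. *)
Lemma exponential_solution (c : R) :
  is_solution t0 b stiffness
    (fun t => c * exp (clock t))
    (fun t => c * damping t * exp (clock t))
    (fun t => c * (damping t ^ 2 - b t * damping t) * exp (clock t)).
Proof.
  intros t _.
  assert (HS : is_derive (fun t : R => clock t) t (damping t)) by apply clock_derive.
  assert (HE : is_derive (fun t : R => damping t) t (- b t * damping t))
    by apply damping_derive.
  repeat split.
  - apply is_derive_D_in; auto_derive; [eexists; eauto|].
    rewrite (is_derive_unique _ _ _ HS); ring.
  - apply is_derive_D_in; auto_derive; [repeat split; eexists; eauto|].
    rewrite (is_derive_unique _ _ _ HS), (is_derive_unique _ _ _ HE); ring.
  - rewrite stiffness_damping; ring.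
Qed.

(** For sg = 1 and sg = -1 this is (u + v) e^(-S) and (u - v) e^S, the
    coordinates that diagonalize du/dS = v, dv/dS = u; the eigenvalues
    are 1 and -1. *)
Lemma diagonal_coordinates (sg : R) (u u1 u2 : R -> R) :
  sg * sg = 1 ->
  is_solution t0 b stiffness u u1 u2 ->
  forall t, t0 <= t ->
    (u t + sg * (u1 t / damping t)) * exp (- sg * clock t) = u t0 + sg * u1 t0.
Proof.
  intros Hsg Hu t Ht.
  set (F := fun t => (clamp t0 u t + sg * (clamp t0 u1 t / damping t))
                     * exp (- sg * clock t)).
  assert (HF : F t = F t0).
  { apply constant_of_zero_derivative with (a := t0); [| |exact Ht].
    - intros s.
      assert (Hcu : continuous (clamp t0 u) s).
      { apply clamp_continuous; intros r Hr.
        destruct (Hu r Hr) as [H _]; exact (cont_deriv _ _ _ _ H). }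
      assert (Hcu1 : continuous (clamp t0 u1) s).
      { apply clamp_continuous; intros r Hr.
        destruct (Hu r Hr) as [_ [H _]]; exact (cont_deriv _ _ _ _ H). }
      assert (HcE := damping_continuous s).
      assert (HcS := clock_continuous s).
      apply continuity_pt_filterlim in Hcu, Hcu1, HcE, HcS.
      apply continuity_pt_filterlim.
      change (continuity_pt
        ((clamp t0 u + mult_real_fct sg (clamp t0 u1 / damping))
         * comp exp (mult_real_fct (- sg) clock))%F s).
      apply continuity_pt_mult.
      + apply continuity_pt_plus; [exact Hcu|].
        apply continuity_pt_scal, continuity_pt_div; auto.
        assert (H := damping_pos s); lra.
      + apply continuity_pt_comp; [now apply continuity_pt_scal|].
        apply derivable_continuous_pt, derivable_pt_exp.
    - intros s Hs.
      destruct (Hu s (Rlt_le _ _ Hs)) as [H0 [H1 Hode]].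
      apply D_in_ray_is_derive in H0, H1; try exact Hs.
      change (is_derive (fun t : R => clamp t0 u t) s (u1 s)) in H0.
      change (is_derive (fun t : R => clamp t0 u1 t) s (u2 s)) in H1.
      assert (HS : is_derive (fun t : R => clock t) s (damping s))
        by apply clock_derive.
      assert (HE : is_derive (fun t : R => damping t) s (- b s * damping s))
        by apply damping_derive.
      assert (Hpos := damping_pos s).
      unfold F; auto_derive.
      + repeat split; try (eexists; eassumption); lra.
      + rewrite (is_derive_unique _ _ _ H0), (is_derive_unique _ _ _ H1),
          (is_derive_unique _ _ _ HS), (is_derive_unique _ _ _ HE).
        rewrite !clamp_eq by lra.
        rewrite stiffness_damping in Hode.
        replace (u2 s) with (damping s ^ 2 * u s - b s * u1 s) by lra.
        set (e := exp _); clearbody e.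
        (* u'' is replaced by means of the equation, and E' = - b E cancels
           the term with b; only the two u' terms remain *)
        transitivity ((1 - sg * sg) * (e * u1 s)); [field; lra|].
        rewrite Hsg; ring. }
  unfold F in HF; rewrite !clamp_eq in HF by lra.
  rewrite HF, damping_t0, clock_t0, Rmult_0_r, exp_0; field.
Qed.

(** u + v and u - v are multiples of e^S and e^(-S) by constants, and both
    exponentials are at most e^M because 0 <= S <= M. *)
Lemma solution_energy_bound (M : R) (u u1 u2 : R -> R) :
  is_solution t0 b stiffness u u1 u2 ->
  forall t, t0 <= t -> clock t <= M ->
    u t ^ 2 + (u1 t / damping t) ^ 2 <= exp M ^ 2 * (u t0 ^ 2 + u1 t0 ^ 2).
Proof.
  intros Hu t Ht HM.
  assert (Hp := diagonal_coordinates 1 u u1 u2 ltac:(lra) Hu t Ht).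
  assert (Hq := diagonal_coordinates (-1) u u1 u2 ltac:(lra) Hu t Ht).
  set (v := u1 t / damping t) in *.
  replace (- (1) * clock t) with (- clock t) in Hp by ring.
  replace (- (-1) * clock t) with (clock t) in Hq by ring.
  assert (HS := clock_nonneg t Ht).
  assert (Hinv : exp (clock t) * exp (- clock t) = 1)
    by (rewrite <- exp_plus, Rplus_opp_r; apply exp_0).
  assert (Hup : exp (clock t) <= exp M)
    by (destruct HM as [H | ->]; [left; now apply exp_increasing | right; auto]).
  assert (Hlow : exp (- clock t) <= exp M)
    by (apply Rle_trans with (exp (clock t)); [|exact Hup];
        destruct (Req_dec (- clock t) (clock t)) as [-> | Hne];
        [right; auto | left; apply exp_increasing; lra]).
  assert (He := exp_pos (clock t)); assert (He' := exp_pos (- clock t)).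
  set (x := exp (clock t)) in *; set (y := exp (- clock t)) in *.
  set (m := exp M) in *; clearbody x y m v.
  (* u + v = p x and u - v = q y, where p and q are the initial values *)
  assert (Hplus : u t + v = (u t0 + u1 t0) * x).
  { replace (u t0 + u1 t0) with (u t0 + 1 * u1 t0) by ring.
    rewrite <- Hp.
    replace (_ * y * x) with ((u t + 1 * v) * (x * y)) by ring.
    rewrite Hinv; ring. }
  assert (Hminus : u t - v = (u t0 - u1 t0) * y).
  { replace (u t0 - u1 t0) with (u t0 + -1 * u1 t0) by ring.
    rewrite <- Hq.
    replace (_ * x * y) with ((u t + -1 * v) * (x * y)) by ring.
    rewrite Hinv; ring. }
  assert (Hx : x ^ 2 <= m ^ 2) by (apply pow_incr; lra).
  assert (Hy : y ^ 2 <= m ^ 2) by (apply pow_incr; lra).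
  (* parallelogram law, at t and at t0 *)
  replace (u t ^ 2 + v ^ 2) with (((u t + v) ^ 2 + (u t - v) ^ 2) / 2) by field.
  replace (u t0 ^ 2 + u1 t0 ^ 2)
    with (((u t0 + u1 t0) ^ 2 + (u t0 - u1 t0) ^ 2) / 2) by field.
  rewrite Hplus, Hminus, !Rpow_mult_distr.
  assert (H1 := Rmult_le_compat_l _ _ _ (pow2_ge_0 (u t0 + u1 t0)) Hx).
  assert (H2 := Rmult_le_compat_l _ _ _ (pow2_ge_0 (u t0 - u1 t0)) Hy).
  lra.
Qed.

Lemma stable_iff_clock_bounded :
  (forall t, 0 <= b t) ->
  zero_solution_stable t0 b stiffness <->
  exists M, forall t, t0 <= t -> clock t <= M.
Proof.
  intros Hb; split.
  - intros Hst.
    destruct (Hst 1 Rlt_0_1) as [d [Hd H]].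
    (* initial data (c, c) have squared norm 2 c^2 = d^2 / 2 *)
    set (c := d / 2).
    assert (Hc : 0 < c) by (unfold c; lra).
    exists (/ c); intros t Ht.
    specialize (H _ _ _ (exponential_solution c)); cbv beta in H.
    rewrite clock_t0, damping_t0, exp_0 in H.
    assert (Hsmall : (c * 1) ^ 2 + (c * 1 * 1) ^ 2 < d ^ 2) by (unfold c; nra).
    specialize (H Hsmall t Ht).
    assert (He := exp_ineq1_le (clock t)).
    assert (Hlt : c * exp (clock t) < 1).
    { assert (H0 := pow2_ge_0 (c * damping t * exp (clock t))).
      assert (H1 := Rmult_lt_0_compat _ _ Hc (exp_pos (clock t))).
      nra. }
    apply Rle_trans with (exp (clock t)); [lra|].
    apply Rmult_le_reg_l with c; [exact Hc|].
    rewrite Rinv_r by lra; lra.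
  - intros [M HM] eps Heps.
    assert (HeM := exp_pos M).
    exists (eps / exp M); split; [now apply Rdiv_lt_0_compat|].
    intros u u1 u2 Hu Hinit t Ht.
    assert (Hbound := solution_energy_bound M u u1 u2 Hu t Ht (HM t Ht)).
    assert (HE : damping t <= 1).
    { rewrite <- exp_0; unfold damping.
      assert (HB : 0 <= RInt b t0 t)
        by (apply RInt_ge_0; auto using ex_RInt_cont).
      destruct HB as [HB | <-];
        [left; apply exp_increasing; lra | rewrite Ropp_0; right; auto]. }
    assert (HE0 := damping_pos t).
    assert (Hv : u1 t ^ 2 <= (u1 t / damping t) ^ 2).
    { set (v := u1 t / damping t).
      replace (u1 t) with (damping t * v) by (unfold v; field; lra).
      rewrite Rpow_mult_distr.
      assert (damping t ^ 2 <= 1) by nra.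
      assert (Hv2 := pow2_ge_0 v); nra. }
    assert (Heq : exp M ^ 2 * (eps / exp M) ^ 2 = eps ^ 2) by (field; lra).
    assert (exp M ^ 2 * (u t0 ^ 2 + u1 t0 ^ 2) < eps ^ 2).
    { rewrite <- Heq; apply Rmult_lt_compat_l; [now apply pow_lt | exact Hinit]. }
    lra.
Qed.

End Damped.

Theorem mainTheorem4 (t0 : R) (b : R -> R)
    (b_cont : forall t : R, t0 <= t -> continue_in b (ray t0) t)
    (b_nonneg : forall t : R, t0 <= t -> 0 <= b t) :
  zero_solution_stable t0 b (fun t => - exp (- 2 * RInt b t0 t)) <->
  ex_RInt_gen (fun s => exp (- RInt b t0 s)) (at_point t0) (Rbar_locally p_infty).
Proof.
  set (b' := clamp t0 b).
  assert (Hb' : forall t, continuous b' t) by now apply clamp_continuous.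
  assert (Hpos : forall t, 0 <= b' t) by (intros t; apply b_nonneg, Rmax_l).
  assert (Hbb : forall t, t0 <= t -> b' t = b t) by (intros; now apply clamp_eq).
  assert (HRInt : forall t, t0 <= t -> RInt b' t0 t = RInt b t0 t).
  { intros t Ht; apply RInt_ext; intros x.
    rewrite Rmin_left by lra; intros Hx; apply Hbb; lra. }
  assert (Hk : forall t, t0 <= t ->
            stiffness t0 b' t = - exp (- 2 * RInt b t0 t))
    by (intros t Ht; unfold stiffness; now rewrite HRInt).
  transitivity (zero_solution_stable t0 b' (stiffness t0 b')).
  { split; apply zero_solution_stable_ext; intros t Ht; auto using eq_sym. }
  rewrite stable_iff_clock_bounded by auto.
  unfold clock.
  rewrite <- ex_RInt_gen_iff_bounded;
    [| now apply damping_continuous | intros t; apply Rlt_le, damping_pos].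
  assert (Hray : filter_prod (at_point t0) (Rbar_locally p_infty)
            (fun ab => forall x, Rmin (fst ab) (snd ab) < x < Rmax (fst ab) (snd ab) ->
               damping t0 b' x = exp (- RInt b t0 x))).
  { apply Filter_prod with (Q := fun x => x = t0) (R := fun t => t0 < t);
      [reflexivity | now exists t0|].
    intros x t -> Ht s; simpl; rewrite Rmin_left by lra; intros Hs.
    unfold damping; rewrite HRInt by lra; reflexivity. }
  split; apply ex_RInt_gen_ext; try exact Hray.
  revert Hray; apply filter_imp; intros ab H x Hx; symmetry; auto.
Qed.
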